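(* Let $X$ be a compact Hausdorff space with Lebesgue dimension $\dim(X)$, and let $m \ge 1$ be an integer. Then the squaring mapping $$\alpha_m \colon \left(C(X)_{\mathrm{sa}}\right)^m \to C(X)_+, \qquad \alpha_m(f_1,\dots,f_m) = \sum_{i=1}^m f_i^2,$$ is open if and only if $m-1 \ge \dim(X)$.
   Context: $C(X)$ is the unital $C^*$-algebra of continuous complex-valued functions on $X$ with the supremum norm. $C(X)_{\mathrm{sa}}$ is the set of its self-adjoint elements (the real-valued continuous functions), and $C(X)_+$ is the set of its positive elements (the continuous functions with values in $[0,\infty)$). Both carry the norm topology inherited from $C(X)$, and $(C(X)_{\mathrm{sa}})^m$ carries the product topology. A map is open if it sends open sets to open sets of the codomain; here openness is relative to $C(X)_+$. Equivalently, for all $(f_1,\dots,f_m)\in (C(X)_{\mathrm{sa}})^m$ and every $\varepsilon>0$ there is $\delta>0$ such that for every $g\in C(X)_+$ with $\|\sum_{k=1}^m f_k^2 - g\|<\delta$ there is an $m$-tuple $(g_1,\dots,g_m)$ in $C(X)_{\mathrm{sa}}$ with $\sum_{k=1}^m g_k^2 = g$ and $\sum_{k=1}^m\|f_k-g_k\|<\varepsilon$. Lebesgue dimension: for a non-negative integer $n$, a compact Hausdorff space $X$ has $\dim(X)\le n$ if for every closed subset $F$ of $X$, each continuous map $F\to S^n$ has a continuous extension $X\to S^n$, where $S^n$ is the unit sphere in $\mathbb{R}^{n+1}$ (so $S^0=\{-1,1\}$). $\dim(X)$ is the least non-negative integer $n$ with $\dim(X)\le n$, and $\dim(X)=\infty$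 if there is no such $n$. *)

(* Defs.v *)
From HB Require Import structures.
From mathcomp Require Import all_boot all_order all_algebra.
From mathcomp Require Import all_classical all_reals all_analysis.

Set Implicit Arguments.
Unset Strict Implicit.
Unset Printing Implicit Defensive.

Import Order.TTheory GRing.Theory Num.Theory.
Import numFieldNormedType.Exports.

Local Open Scope classical_set_scope.
Local Open Scope ring_scope.

Section continuous_functions.
Context {R : realType} {X : topologicalType}.

Definition cont_pred : pred (X -> R) := fun f => `[< continuous f >].

Lemma cont_subring_closed : subring_closed cont_pred.
Proof.
split; first by apply/asboolP => x; exact: cvg_cst.
- move=> f g /asboolP cf /asboolP cg; apply/asboolP => x.
  by apply: cvgB; [exact: cf | exact: cg].
- move=> f g /asboolP cf /asboolP cg; apply/asboolP => x.
  by apply: cvgM; [exact: cf | exact: cg].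
Qed.

Lemma cont_scaler_closed : GRing.scaler_closed cont_pred.
Proof.
move=> a f /asboolP cf; apply/asboolP => x.
by apply: cvgM; [exact: cvg_cst | exact: cf].
Qed.

HB.instance Definition _ :=
  GRing.isSubringClosed.Build (X -> R) cont_pred cont_subring_closed.
HB.instance Definition _ :=
  GRing.isScaleClosed.Build R (X -> R) cont_pred cont_scaler_closed.

End continuous_functions.

(* C(X)_sa, whose elements are the real-valued continuous functions on X.     *)
(* The compactness proof is an (irrelevant) parameter of the type because it  *)
(* is what makes the supremum norm below finite, hence a norm.                *)
Record Csa (R : realType) (X : topologicalType) (cX : compact [set: X]) :=
  MkCsa { Csa_fun :> X -> R ; Csa_prop : Csa_fun \in @cont_pred R X }.
Arguments Csa R {X} cX.

Section Csa_structure.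
Context {R : realType} {X : topologicalType} (cX : compact [set: X]).
Notation C := (Csa R cX).

HB.instance Definition _ := [isSub for @Csa_fun R X cX].
HB.instance Definition _ := [Choice of C by <:].
HB.instance Definition _ :=
  GRing.SubChoice_isSubComPzRing.Build _ _ C (GRing.subringClosedP _).
HB.instance Definition _ := [SubZmodule_isSubLmodule of C by <:].

Lemma Csa_continuous (f : C) : continuous f.
Proof. by case: f => f /= /asboolP. Qed.

Definition sup_norm (f : C) : R := sup (range (fun x => `|f x|)).

Lemma has_ubound_Csa (f : C) : has_ubound (range (fun x => `|f x|)).
Proof.
have cf : continuous (fun x => `|f x|).
  by move=> x; apply: cvg_norm; exact: Csa_continuous.
have /compact_bounded[M [_ /(_ (M + 1))]] :
    compact ((fun x => `|f x|) @` [set: X]).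
  by apply: continuous_compact => //; exact: continuous_subspaceT.
rewrite ltrDl ltr01 => /(_ isT) hM; exists (M + 1) => _ [x _ <-].
by rewrite -[leLHS]normr_id; apply: hM; exists x.
Qed.

Lemma sup_norm_ub (f : C) x : `|f x| <= sup_norm f.
Proof. by apply: ub_le_sup; [exact: has_ubound_Csa | exists x]. Qed.

Lemma sup_norm_le (f : C) (r : R) :
  0 <= r -> (forall x, `|f x| <= r) -> sup_norm f <= r.
Proof.
move=> r0 fr; rewrite /sup_norm.
have [->|/set0P ne] := eqVneq (range (fun x => `|f x|)) set0.
  by rewrite sup0.
by apply: ge_sup => // _ [x _ <-].
Qed.

Lemma sup_norm_ge0 (f : C) : 0 <= sup_norm f.
Proof.
rewrite /sup_norm.
have [->|/set0P [_ [x _ _]]] := eqVneq (range (fun x => `|f x|)) set0.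
  by rewrite sup0.
exact: le_trans (normr_ge0 (f x)) (sup_norm_ub f x).
Qed.

Lemma ler_sup_normD (f g : C) : sup_norm (f + g) <= sup_norm f + sup_norm g.
Proof.
apply: sup_norm_le => [|x]; first by rewrite addr_ge0// sup_norm_ge0.
by apply: le_trans (ler_normD (f x) (g x)) _; rewrite lerD// sup_norm_ub.
Qed.

Lemma sup_normZ (a : R) (f : C) : sup_norm (a *: f) = `|a| * sup_norm f.
Proof.
apply/eqP; rewrite eq_le; apply/andP; split.
  apply: sup_norm_le => [|x]; first by rewrite mulr_ge0// sup_norm_ge0.
  have -> : (a *: f : C) x = a * f x by [].
  by rewrite normrM ler_wpM2l// sup_norm_ub.
have [->|a0] := eqVneq a 0; first by rewrite normr0 mul0r sup_norm_ge0.
rewrite -ler_pdivlMl ?normr_gt0//; apply: sup_norm_le => [|x].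
  by rewrite mulr_ge0 ?invr_ge0// sup_norm_ge0.
rewrite ler_pdivlMl ?normr_gt0// -normrM.
exact: sup_norm_ub (a *: f) x.
Qed.

Lemma sup_norm_eq0 (f : C) : sup_norm f = 0 -> f = 0.
Proof.
move=> f0; apply/val_inj/funext => x; apply/eqP.
by rewrite -normr_le0; rewrite -[leRHS]f0; exact: sup_norm_ub.
Qed.

HB.instance Definition _ :=
  @Lmodule_isNormed.Build R C sup_norm ler_sup_normD sup_normZ sup_norm_eq0.

Definition Cpos : set C := [set f : C | forall x, 0 <= f x].

Lemma Csa_sumE (I : Type) (r : seq I) (F : I -> C) x :
  (\sum_(i <- r) F i) x = \sum_(i <- r) F i x.
Proof. by elim/big_ind2 : _ => // f a g b <- <-. Qed.

Lemma sum_sqr_Cpos (m : nat) (f : {ptws 'I_m -> C}) :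
  \sum_(i < m) f i ^+ 2 \in Cpos.
Proof.
rewrite inE => x; rewrite Csa_sumE; apply: sumr_ge0 => i _.
by have -> : (f i ^+ 2 : C) x = f i x ^+ 2 by []; exact: sqr_ge0.
Qed.

(* (C(X)_sa)^m carries the product topology, and C(X)_+ (a set_type) the      *)
(* topology induced by C(X)_sa.                                               *)
Definition squaring (m : nat) (f : {ptws 'I_m -> C}) : Cpos :=
  exist _ (\sum_(i < m) f i ^+ 2) (sum_sqr_Cpos f).

End Csa_structure.
Arguments Cpos R {X} cX _.
Arguments squaring R {X} cX m f.

Definition open_map {S T : topologicalType} (f : S -> T) : Prop :=
  forall U : set S, open U -> open (f @` U).

(* The library norm on 'rV is the max norm, hence the explicit equation.      *)
Definition sphere (R : realType) (n : nat) : set 'rV[R]_n.+1 :=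
  [set v | \sum_(i < n.+1) v ord0 i ^+ 2 = 1].
Arguments sphere R n : clear implicits.

(* A map F -> S^n is a total function restricted to F: its values outside F  *)
(* are junk, so only continuity within F and f @` F are constrained.          *)
Definition dim_le (R : realType) (X : topologicalType) (n : nat) : Prop :=
  forall F : set X, closed F ->
  forall f : X -> 'rV[R]_n.+1,
    {within F, continuous f} -> f @` F `<=` sphere R n ->
  exists g : X -> 'rV[R]_n.+1,
    [/\ continuous g, range g `<=` sphere R n & {in F, g =1 f}].

Definition Lebesgue_dim (R : realType) (X : topologicalType) : \bar R :=
  if pselect (exists n, `[< dim_le R X n >]) is left h
  then (ex_minn h)%:R%:E else +oo%E.

(* Main.v *)
Require Import Defs.
From mathcomp Require Import all_boot all_order all_algebra.
From mathcomp Require Import all_classical all_reals all_analysis.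
From mathcomp Require Import lra.
Import numFieldNormedType.Exports.
Import Order.TTheory GRing.Theory Num.Theory.

Set Implicit Arguments.
Unset Strict Implicit.
Unset Printing Implicit Defensive.

Local Open Scope classical_set_scope.
Local Open Scope ring_scope.

(** Write |u| for the Euclidean norm of u in R^m, and view an m-tuple of real
    functions on X as a map f : X -> R^m. Openness of the squaring map says
    that every g >= 0 uniformly close to |f|^2 is |h|^2 for some h uniformly
    close to f; this is [sq_lifts], and [open_squaringP] translates.

    If maps from closed subsets of X to the sphere S^n extend, then sums of
    n+1 squares lift ([dim_le_sq_lifts]). The direction f/|f| is defined on the
    closed set where |f| >= eta; extend it to p : X -> S^n and take
    h = sqrt(g) p. Where |f| >= eta both f and h point along p, and their
    lengths are close; elsewhere both lengths are small, so the direction does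
    not matter.

    Conversely, if sums of n+1 squares lift, let f : F -> S^n be continuous on
    a closed set F ([sq_lifts_dim_le]). Tietze's theorem extends it to
    t : X -> R^(n+1), which may vanish outside F. Lifting max(|t|^2, d), where
    d is the tolerance on |t|^2, gives a nowhere vanishing h close to t. Gluing
    h to t, so that t is used only where |t| is bounded below, keeps the values
    of f on F and never vanishes, so that the result can be normalized.

    The Lebesgue dimension is the least n such that maps to S^n extend, and a
    priori nothing is known about larger spheres. Monotonicity is supplied by
    the squaring maps: lifting m squares implies lifting m+1 ([sq_liftsS]). *)

(** * Sums of squares *)

Section sums_of_squares.
Context {R : realType}.

Lemma sqr_le_sum_sqr (m : nat) (u : 'I_m -> R) i :
  u i ^+ 2 <= \sum_(j < m) u j ^+ 2.
Proof. by rewrite (bigD1 i)//= lerDl sumr_ge0// => j _; exact: sqr_ge0. Qed.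

Lemma sum_sqr_ge0 (m : nat) (u : 'I_m -> R) : 0 <= \sum_(j < m) u j ^+ 2.
Proof. by apply: sumr_ge0 => j _; exact: sqr_ge0. Qed.

Lemma sum_sqrM (m : nat) (u : 'I_m -> R) c :
  \sum_(j < m) (c * u j) ^+ 2 = c ^+ 2 * \sum_(j < m) u j ^+ 2.
Proof. by rewrite mulr_sumr; apply: eq_bigr => i _; rewrite exprMn. Qed.

Lemma norm_le_sqrt_sum_sqr (m : nat) (u : 'I_m -> R) i :
  `|u i| <= Num.sqrt (\sum_(j < m) u j ^+ 2).
Proof. by rewrite -sqrtr_sqr ler_wsqrtr// sqr_le_sum_sqr. Qed.

Lemma sum_sqr_normalize (m : nat) (u : 'I_m -> R) :
  0 < \sum_(j < m) u j ^+ 2 ->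
  \sum_(i < m) ((Num.sqrt (\sum_(j < m) u j ^+ 2))^-1 * u i) ^+ 2 = 1.
Proof.
move=> u0; rewrite sum_sqrM exprVn sqr_sqrtr ?ltW// mulVf// gt_eqF//.
Qed.

Lemma sqrtr_le_of_sqr (a b : R) : 0 <= b -> a <= b ^+ 2 -> Num.sqrt a <= b.
Proof. by move=> b0 ab; rewrite -(ger0_norm b0) -sqrtr_sqr ler_wsqrtr. Qed.

Lemma sqrtr_dist_le (a b : R) : 0 <= a -> 0 <= b ->
  `|Num.sqrt a - Num.sqrt b| <= Num.sqrt `|a - b|.
Proof.
move=> a0 b0; rewrite -(ler_pXn2r (ltn0Sn 1))// ?nnegrE ?sqrtr_ge0//.
rewrite sqr_sqrtr// -{2}(sqr_sqrtr a0) -{2}(sqr_sqrtr b0) subr_sqr normrM.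
rewrite expr2 ler_wpM2l// ler_norml.
have sa := sqrtr_ge0 a; have sb := sqrtr_ge0 b.
by rewrite [`|_ + _|]ger0_norm ?addr_ge0//; apply/andP; split; lra.
Qed.

End sums_of_squares.

(** * Lifting perturbations of a sum of squares *)

Section lifting.
Context {R : realType} {X : topologicalType}.

(** Openness of the squaring map on m-tuples, stated pointwise for plain
    functions. A weak pointwise bound is the same as a weak bound on the
    supremum norm, without appeal to the supremum being attained. *)
Definition sq_lifts (m : nat) : Prop :=
  forall f : 'I_m -> X -> R, (forall i, continuous (f i)) ->
  forall e : R, 0 < e -> exists2 d : R, 0 < d &
  forall g : X -> R, continuous g -> (forall x, 0 <= g x) ->
    (forall x, `|\sum_(i < m) f i x ^+ 2 - g x| <= d) ->
  exists h : 'I_m -> X -> R, [/\ forall i, continuous (h i),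
    forall x, \sum_(i < m) h i x ^+ 2 = g x &
    forall i x, `|f i x - h i x| <= e].

Lemma continuous_sum_sqr (m : nat) (f : 'I_m -> X -> R) :
  (forall i, continuous (f i)) -> continuous (fun x => \sum_(i < m) f i x ^+ 2).
Proof.
move=> cf; apply: continuous_big => [p|i _ x]; first exact: add_continuous.
exact: (continuous_comp (cf i x) (@exprn_continuous R 2 _)).
Qed.

Lemma continuous_sqrt_comp (f : X -> R) :
  continuous f -> continuous (fun x => Num.sqrt (f x)).
Proof.
by move=> cf x; exact: (continuous_comp (cf x) (@sqrt_continuous R _)).
Qed.

Lemma continuous_maxr (f g : X -> R) : continuous f -> continuous g ->
  continuous (fun x => Num.max (f x) (g x)).
Proof. by move=> cf cg x; exact: (continuous_max (cf x) (cg x)). Qed.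

Lemma continuous_minr (f g : X -> R) : continuous f -> continuous g ->
  continuous (fun x => Num.min (f x) (g x)).
Proof. by move=> cf cg x; exact: (continuous_min (cf x) (cg x)). Qed.

Lemma continuous_rowZ (n : nat) (c : X -> R) (f : 'I_n -> X -> R) :
  continuous c -> (forall i, continuous (f i)) ->
  continuous (fun x => \row_i (c x * f i x)).
Proof.
move=> cc cf x; apply/cvg_ballP => /= e e0.
have : \forall y \near x, forall i, ball (c x * f i x) e (c y * f i y).
  apply: filter_forall => i.
  have /cvg_ballP : c y * f i y @[y --> x] --> c x * f i x.
    by apply: cvgM; [exact: cc|exact: cf].
  by apply.
by apply: filterS => y xy; split=> // j i; rewrite !mxE.
Qed.

(** The first coordinate is truncated to the interval between -sqrt(g) and
    sqrt(g); its square is then min(f_0^2, g). What remains, max(g - f_0^2, 0),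
    is nonnegative and as close to the sum of the other squares as g is to the
    whole sum, so that it lifts to m coordinates. *)
Lemma sq_liftsS (m : nat) : sq_lifts m -> sq_lifts m.+1.
Proof.
move=> lm f cf e e0.
have [d d0 hd] := lm (fun i => f (lift ord0 i)) (fun i => cf _) e e0.
exists (Num.min d (e ^+ 2)) => [|g cg g0 fg]; first by rewrite lt_min d0 exprn_gt0.
pose s x := Num.sqrt (g x).
pose h0 x := Num.max (- s x) (Num.min (f ord0 x) (s x)).
have cs : continuous s by exact: continuous_sqrt_comp.
have ch0 : continuous h0.
  apply: continuous_maxr; last by apply: continuous_minr.
  by move=> x; apply: cvgN; exact: cs.
have h0P x : [/\ h0 x ^+ 2 <= g x,
    `|\sum_(i < m) f (lift ord0 i) x ^+ 2 - (g x - h0 x ^+ 2)| <= d &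
    `|f ord0 x - h0 x| <= e].
  have s0 : 0 <= s x := sqrtr_ge0 _.
  have sE : s x ^+ 2 = g x := sqr_sqrtr (g0 x).
  have S0 := sum_sqr_ge0 (fun i => f (lift ord0 i) x).
  have := fg x; rewrite big_ord_recl /= le_min => /andP[].
  rewrite /h0; move: S0; set S := \sum_(i < m) _ => S0.
  rewrite -sE; move: (s x) (f ord0 x) s0 => t a t0.
  rewrite !ler_norml => /andP[A1 A2] /andP[B1 B2].
  (* In turn the truncation is a, -t and t; the last case is contradictory. *)
  have [ta|ta] := leP a t; have [tb|tb] := leP (- t) _.
  - split; [nra|apply/andP; split; nra|rewrite subrr; lra].
  - split; [nra|apply/andP; split; nra|apply/andP; split; nra].
  - split; [nra|apply/andP; split; nra|apply/andP; split; nra].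
  - lra.
have cg' : continuous (fun x => g x - h0 x ^+ 2).
  move=> x; apply: cvgB; first exact: cg.
  exact: (continuous_comp (ch0 x) (@exprn_continuous R 2 _)).
have [||h [ch hE fh]] := hd _ cg'.
- by move=> x; have [h0g _ _] := h0P x; rewrite subr_ge0.
- by move=> x; have [] := h0P x.
exists (fun i => oapp h h0 (unlift ord0 i)); split.
- by move=> i; case: unliftP => [j _|_]; [exact: ch|exact: ch0].
- move=> x; rewrite big_ord_recl unlift_none /=.
  under eq_bigr do rewrite liftK /=.
  by rewrite hE subrKC.
- move=> i x; case: unliftP => [j ->|->]; first exact: fh.
  by have [] := h0P x.
Qed.

(** The extension property is applied to the direction of f on the set where f
    is not small; the length of the lift is then forced to be sqrt(g). *)
Lemma dim_le_sq_lifts (n : nat) : dim_le R X n -> sq_lifts n.+1.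
Proof.
move=> dn f cf e e0; exists ((e / 3) ^+ 2); first by rewrite exprn_gt0// divr_gt0.
move=> g cg g0 fg; pose N x := \sum_(i < n.+1) f i x ^+ 2.
have cN : continuous N by exact: continuous_sum_sqr.
have N0 x : 0 <= N x by exact: sum_sqr_ge0.
pose eta : R := e / 3; have eta0 : 0 < eta by rewrite divr_gt0.
pose F := [set x | eta ^+ 2 <= N x].
(* Bounding the norm of f below by eta makes the direction u continuous on all
   of X; it has norm 1 only on F. *)
pose r x := Num.sqrt (Num.max (N x) (eta ^+ 2)).
have r0 x : 0 < r x by rewrite sqrtr_gt0 lt_max exprn_gt0 ?orbT.
have rF x : F x -> r x = Num.sqrt (N x) by move=> Fx; rewrite /r max_l.
pose u x : 'rV[R]_n.+1 := \row_i ((r x)^-1 * f i x).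
have clF : closed F.
  have -> : F = N @^-1` [set t | eta ^+ 2 <= t] by [].
  by apply: preimage_closed => //; exact: closed_ge.
have cr : continuous r.
  apply: continuous_sqrt_comp; apply: continuous_maxr => // x.
  exact: cvg_cst.
have cu : continuous u.
  apply: continuous_rowZ => // x.
  by apply: cvgV; [rewrite gt_eqF|exact: cr].
have uF : u @` F `<=` sphere R n.
  move=> _ [x Fx <-]; rewrite /sphere /=; under eq_bigr do rewrite mxE rF//.
  by apply: sum_sqr_normalize; apply: lt_le_trans Fx; exact: exprn_gt0.
have [p [cp pS pu]] := dn F clF u (continuous_subspaceT cu) uF.
have pS1 x : \sum_(i < n.+1) p x ord0 i ^+ 2 = 1 by apply: pS; exists x.
exists (fun i x => Num.sqrt (g x) * p x ord0 i); split.
- move=> i x; apply: cvgM; first exact: continuous_sqrt_comp.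
  exact: (continuous_comp (cp x) (@coord_continuous R _ _ _ _ _)).
- by move=> x; rewrite sum_sqrM pS1 mulr1 sqr_sqrtr.
move=> i x.
have p1 : `|p x ord0 i| <= 1.
  by have := norm_le_sqrt_sum_sqr (p x ord0) i; rewrite pS1 sqrtr1.
have sNg : `|Num.sqrt (N x) - Num.sqrt (g x)| <= eta.
  apply: le_trans (sqrtr_dist_le (N0 x) (g0 x)) _.
  by apply: sqrtr_le_of_sqr; [exact: ltW|exact: fg].
have [Fx|nFx] := pselect (F x).
  have -> : f i x = Num.sqrt (N x) * p x ord0 i.
    by rewrite pu ?inE// mxE rF// mulVKf// -rF// gt_eqF.
  rewrite -mulrBl normrM; apply: (@le_trans _ _ eta).
    by rewrite -[leRHS]mulr1 ler_pM.
  by rewrite /eta; lra.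
have sN : Num.sqrt (N x) <= eta.
  apply: sqrtr_le_of_sqr; first exact: ltW.
  by move/negP: nFx; rewrite -ltNge => /ltW.
have fN := norm_le_sqrt_sum_sqr (f ^~ x) i.
apply: le_trans (ler_normB _ _) _.
rewrite normrM ger0_norm ?sqrtr_ge0//.
have : Num.sqrt (g x) * `|p x ord0 i| <= Num.sqrt (g x).
  by rewrite ler_piMr ?sqrtr_ge0.
rewrite -/(N x) in fN; move: sNg; rewrite ler_norml /eta in sN *.
by move=> /andP[? ?]; lra.
Qed.

(** Lifting a perturbation of |t|^2 that is bounded below turns a Tietze
    extension t, which may have zeros, into a nowhere vanishing map close to
    it. *)
Lemma sq_lifts_dim_le (n : nat) : normal_space X ->
  sq_lifts n.+1 -> dim_le R X n.
Proof.
move=> nX ln F clF f cf fS.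
have fF1 x : F x -> \sum_(i < n.+1) f x ord0 i ^+ 2 = 1.
  by move=> Fx; apply: fS; exists x.
have /choice[t tP] : forall i, exists t : X -> R,
    {in F, forall x, f x ord0 i = t x} /\ continuous t.
  move=> i; have [|||t [tf ct _]] :=
    @continuous_bounded_extension X R nX F clF (fun x => f x ord0 i) 1.
  - exact: ltr01.
  - move=> x.
    exact: (continuous_comp (cf x) (@coord_continuous R _ _ _ _ _)).
  - move=> x Fx; rewrite -sqrtr1 -(fF1 _ Fx).
    exact: norm_le_sqrt_sum_sqr.
  - by exists t.
have ct i : continuous (t i) := (tP i).2.
pose N x := \sum_(i < n.+1) t i x ^+ 2.
have cN : continuous N by exact: continuous_sum_sqr.
have N0 x : 0 <= N x by exact: sum_sqr_ge0.
have NF x : F x -> N x = 1.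
  move=> Fx; rewrite -(fF1 _ Fx); apply: eq_bigr => i _.
  by rewrite (tP i).1 ?inE.
(* With n+1 coordinates of absolute value at most e <= 1, the sum of squares is
   at most (n+1) e = 1/2. *)
pose e : R := (2 * n.+1%:R)^-1.
have e0 : 0 < e by rewrite invr_gt0 mulr_gt0.
have [d d0 hd] := ln t ct e e0.
have cNd : continuous (fun x => Num.max (N x) d).
  by apply: continuous_maxr => // x; exact: cvg_cst.
have [||h [ch hE th]] := hd _ cNd.
- by move=> x; rewrite le_max N0.
- move=> x; rewrite ler_norml; have := N0 x.
  by rewrite -/(N x); have [] := leP (N x) d => ? ?; apply/andP; split; lra.
(* The weight of t: it is 1 on F, where N = 1, and 0 where N <= 1/2. *)
pose l x := Num.min 1 (Num.max 0 (2 * N x - 1)).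
have cl : continuous l.
  apply: continuous_minr; first by move=> x; exact: cvg_cst.
  apply: continuous_maxr => x; first exact: cvg_cst.
  apply: cvgB; last exact: cvg_cst.
  by apply: cvgM; [exact: cvg_cst|exact: cN].
pose w i x := l x * t i x + (1 - l x) * h i x.
have cw i : continuous (w i).
  move=> x; apply: cvgD; apply: cvgM;
    [exact: cl|exact: ct| |exact: ch].
  by apply: cvgB; [exact: cvg_cst|exact: cl].
have l01 x : 0 <= l x <= 1.
  rewrite /l; have [] := leP 0 (2 * N x - 1); have [] := leP 1 _ => *; apply/andP; split; lra.
have w0 x : 0 < \sum_(i < n.+1) w i x ^+ 2.
  have [Nx|Nx] := leP (2 * N x) 1.
    have -> : \sum_(i < n.+1) w i x ^+ 2 = Num.max (N x) d.
      rewrite -hE; apply: eq_bigr => i _.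
      by rewrite /w /l max_l ?subr_le0// min_r// mul0r add0r subr0 mul1r.
    by rewrite lt_max d0 orbT.
  rewrite lt_neqAle sum_sqr_ge0 andbT eq_sym; apply/negP => /eqP w0.
  (* Here N > 1/2. A zero of w would give t = (1 - l) (t - h), so that every
     coordinate of t would be at most e. *)
  have wi0 i : w i x = 0.
    apply/eqP; rewrite -sqrf_eq0 eq_le sqr_ge0 andbT.
    by rewrite -w0; exact: (sqr_le_sum_sqr (w ^~ x)).
  have ti i : t i x ^+ 2 <= e.
    have te : `|t i x| <= e.
      have -> : t i x = (1 - l x) * (t i x - h i x).
        by move: (wi0 i); rewrite /w; lra.
      rewrite normrM -[leRHS]mul1r ler_pM//.
      by move: (l01 x) => /andP[? ?]; rewrite ger0_norm; lra.
    have e1 : e <= 1 by rewrite invf_le1 ?mulr_gt0// -natrM ler1n.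
    by move: te; rewrite ler_norml => /andP[? ?]; nra.
  have : N x <= \sum_(i < n.+1) e by exact: ler_sum.
  rewrite sumr_const card_ord -mulr_natr /e.
  by rewrite invfM -mulrA mulVf ?pnatr_eq0// mulr1; lra.
exists (fun x => \row_i ((Num.sqrt (\sum_(j < n.+1) w j x ^+ 2))^-1 * w i x)).
split.
- apply: continuous_rowZ => // x.
  apply: cvgV; first by rewrite gt_eqF// sqrtr_gt0.
  by apply: continuous_sqrt_comp; exact: continuous_sum_sqr.
- move=> _ [x _ <-]; rewrite /sphere /=; under eq_bigr do rewrite mxE.
  exact: sum_sqr_normalize.
- move=> x /[!inE] Fx.
  have lx : l x = 1 by rewrite /l NF// max_r ?min_l//; lra.
  have wf i : w i x = f x ord0 i.
    by rewrite /w lx subrr mul0r addr0 mul1r (tP i).1 ?inE.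
  apply/rowP => i; rewrite mxE wf.
  by under eq_bigr do rewrite wf; rewrite fF1// sqrtr1 invr1 mul1r.
Qed.

End lifting.

(** * Openness of the squaring map *)

Section openness.
Context {R : realType} {X : topologicalType} (cX : compact [set: X]).
Notation C := (Csa R cX).

Definition Csa_of (f : X -> R) (cf : continuous f) : C :=
  MkCsa cX (asboolT cf).

(** There are finitely many factors, so the product topology on m-tuples is the
    topology of the maximum norm. *)
Lemma ptws_nbhs_box (m : nat) (f : {ptws 'I_m -> C}) (U : set {ptws 'I_m -> C}) :
  nbhs f U <-> exists2 e : R, 0 < e &
    [set h | forall i, `|f i - h i| < e] `<=` U.
Proof.
pose box e := [set h : {ptws 'I_m -> C} | forall i, `|f i - h i| < e].
split=> [fU|[e e0 eU]].
- have FF : Filter (filter_from [set e : R | 0 < e] box).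
    apply: filter_from_filter; first by exists 1 => /=.
    move=> a b /= a0 b0; exists (Num.min a b); first by rewrite lt_min a0.
    by move=> h /= hab; split=> i; have := hab i; rewrite lt_min => /andP[].
  suff /(_ U fU)[e e0 eU] : filter_from [set e : R | 0 < e] box --> f by exists e.
  apply/cvg_sup => i A; rewrite nbhsE => -[_ [[B oB <-] Bf] BA].
  have /nbhs_normP[e e0 eB] := open_nbhs_nbhs (conj oB Bf).
  by exists e => // h hb; apply: BA; apply: eB; exact: hb.
- refine (@filterS _ (nbhs f) _ (box e) U eU _).
  apply: (@filter_forall {ptws 'I_m -> C} 'I_m
    (fun i h => `|f i - h i| < e) (nbhs f) _) => i.
  refine (@proj_continuous _ (fun=> C) i f [set a | `|f i - a| < e] _).
  by apply/nbhs_normP; exists e.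
Qed.

Lemma sum_sqr_subE (m : nat) (f : 'I_m -> C) (g : C) x :
  (\sum_(i < m) f i ^+ 2 - g) x = \sum_(i < m) f i x ^+ 2 - g x.
Proof.
transitivity ((\sum_(i < m) f i ^+ 2 : C) x - g x); first by [].
by rewrite Csa_sumE.
Qed.

Lemma open_squaringP (m : nat) :
  open_map (squaring R cX m) <-> @sq_lifts R X m.
Proof.
split=> [op f cf e e0|lm U oU].
- pose fC : {ptws 'I_m -> C} := fun i => Csa_of (cf i).
  have : nbhs fC [set h | forall i, `|fC i - h i| < e].
    by apply/ptws_nbhs_box; exists e.
  rewrite nbhsE => -[V [oV Vf] VU].
  have [W oW WV] := op V oV.
  have : W (\sum_(i < m) fC i ^+ 2).
    have : (squaring R cX m @` V) (squaring R cX m fC) by exists fC.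
    by rewrite -WV.
  move=> Wf; have /nbhs_normP[d d0 dW] := open_nbhs_nbhs (conj oW Wf).
  exists (d / 2); first by rewrite divr_gt0.
  move=> g cg g0 fg.
  have gpos : Csa_of cg \in Cpos R cX by rewrite inE.
  have : (set_val @^-1` W) (exist _ (Csa_of cg) gpos : Cpos R cX).
    apply: dW => /=; apply: (@le_lt_trans _ _ (d / 2)).
      apply: sup_norm_le; first by rewrite divr_ge0// ltW.
      move=> x; apply: le_trans (fg x).
      change (`|(\sum_(i < m) fC i ^+ 2 - Csa_of cg) x| <=
              `|\sum_(i < m) f i x ^+ 2 - g x|).
      by rewrite sum_sqr_subE.
    by move: d0 => /=; lra.
  rewrite WV => -[h Vh /(congr1 val) /= hg].
  exists (fun i => Csa_fun (h i)); split.
  - by move=> i; exact: Csa_continuous.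
  - by move=> x; have := congr1 (@Csa_fun R X cX ^~ x) hg; rewrite Csa_sumE.
  - move=> i x; apply: le_trans (ltW (VU _ Vh i)).
    exact: sup_norm_ub (fC i - h i) x.
- rewrite openE => _ [f Uf <-].
  have /ptws_nbhs_box[e e0 eU] := open_nbhs_nbhs (conj oU Uf).
  have [||d d0 hd] := lm (fun i => Csa_fun (f i)) _ (e / 2).
  + by move=> i; exact: Csa_continuous.
  + by rewrite divr_gt0.
  have : nbhs (squaring R cX m f)
      [set g : Cpos R cX | `|\sum_(i < m) f i ^+ 2 - set_val g| < d].
    refine (@initial_continuous (Cpos R cX) C (@set_val C (Cpos R cX))
      (squaring R cX m f) [set a | `|\sum_(i < m) f i ^+ 2 - a| < d] _).
    by apply/nbhs_normP; exists d.
  apply: filterS => -[g gpos] /= fg.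
  have [|x||h [ch hE fh]] := hd g.
  + exact: Csa_continuous.
  + by move: (gpos); rewrite inE; apply.
  + move=> x; apply: le_trans (ltW fg).
    have := sup_norm_ub (\sum_(i < m) f i ^+ 2 - g) x.
    by rewrite sum_sqr_subE.
  exists (fun i => Csa_of (ch i)).
    apply: eU => i; apply: (@le_lt_trans _ _ (e / 2)); last by lra.
    by apply: sup_norm_le => [|x]; [rewrite divr_ge0// ltW|exact: fh].
  apply/val_inj/val_inj/funext => x /=.
  by rewrite -hE Csa_sumE.
Qed.

End openness.

Theorem mainTheorem1 (R : realType) (X : topologicalType)
    (cX : compact [set: X]) (hX : hausdorff_space X) (m : nat) (hm : (1 <= m)%N) :
  open_map (squaring R cX m) <-> (Lebesgue_dim R X <= (m - 1)%N%:R%:E)%E.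
Proof.
case: m hm => // n _; rewrite subn1 /=.
have nX : normal_space X := compact_normal hX cX.
apply: (iff_trans (open_squaringP cX n.+1)).
rewrite /Lebesgue_dim; case: pselect => [ex|nex]; last first.
  split=> // /(sq_lifts_dim_le nX) dn.
  by exfalso; apply: nex; exists n; apply/asboolP.
case: ex_minnP => k /asboolP dk kmin; rewrite lee_fin ler_nat.
split=> [/(sq_lifts_dim_le nX) dn|kn]; first by apply: kmin; apply/asboolP.
(* The extension property is available at the minimal dimension k only; from
   there the lifting property is carried up to n. *)
rewrite -(subnK kn); elim: (n - k)%N => [|j IH]; first exact: dim_le_sq_lifts.
by rewrite addSn; exact: sq_liftsS.
Qed.
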